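(* The following three statements are pairwise equivalent. (1) $f(g,n)<\infty$ for every ordered pair $(g,n)$ of positive integers. (2) The unrestricted direct power $F_2^{\omega}$ has torsion free Abelianization. (3) Every almost locally free group has torsion free Abelianization.
   Context: $F_2=\langle a_1,a_2;\ \rangle$ is the free group of rank $2$, $\omega=\{0,1,2,\dots\}$, and $F_2^{\omega}$ is the unrestricted direct power (the full Cartesian product of countably many copies of $F_2$ indexed by $\omega$). The Abelianization of a group $G$ is $G/[G,G]$. For $z$ in the derived group $[F_2,F_2]$, define $\mathrm{genus}(z)=0$ if $z=1$, and otherwise $\mathrm{genus}(z)=\min\{N : z=[x_1,y_1]\cdots[x_N,y_N] \text{ for some } x_i,y_i\in F_2\}$, where $[x,y]$ denotes the commutator. For each ordered pair $(g,n)$ of positive integers define $f(g,n)=\infty$ if the set $\{\mathrm{genus}(z) : z\in[F_2,F_2],\ \mathrm{genus}(z^n)\le g\}$ is unbounded, and $f(g,n)=\max\{\mathrm{genus}(z) : z\in[F_2,F_2],\ \mathrm{genus}(z^n)\le g\}$ otherwise. Let $L_o$ be the first-order language of group theory, with equality, a binary operation symbol $\cdot$, a unary symbol $^{-1}$ and a constant symbol $1$. A $\Pi_2$-sentence of $L_o$ is a sentence logically equivalent to one of the form $\forall x_1\cdots\forall x_m\exists y_1\cdots\exists y_n\,\psi$ with $\psi$ quantifier-free and containing free at most the variables displayed (vacuous quantifications permitted). $\mathrm{Th}(F_2)\cap\forall\exists$ denotes the set of all $\Pi_2$-sentences of $L_o$ true in $F_2$ (by a theorem of Sacerdote, equivalently,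 true in every non-Abelian free group). A group is almost locally free if it is a model of $\mathrm{Th}(F_2)\cap\forall\exists$. *)

(* Defs.v *)
(* Groups are the possibly infinite groupType of monoid.v; its choiceType component
   is no restriction, since classically every type has a choice structure. *)
From HB Require Import structures.
From mathcomp Require Import all_boot all_order.
From mathcomp Require Import boolp classical_sets.

Set Implicit Arguments.
Unset Strict Implicit.
Unset Printing Implicit Defensive.

Local Open Scope classical_set_scope.
Local Open Scope group_scope.

(* The letter (x, true) stands for the generator x, (x, false) for x^-1. *)
Definition letter (X : choiceType) : choiceType := (X * bool)%type.

Definition inv_letter (X : choiceType) (a : letter X) : letter X := (a.1, ~~ a.2).

Definition reduced (X : choiceType) (w : seq (letter X)) : bool :=
  sorted (fun a b => b != inv_letter a) w.

Record freegroup (X : choiceType) : Type := FreeGroup {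
  fg_word : seq (letter X);
  fg_wordP : reduced fg_word
}.
HB.instance Definition _ (X : choiceType) := [isSub for @fg_word X].
HB.instance Definition _ (X : choiceType) := [Choice of freegroup X by <:].

Section FreeGroup.
Variable X : choiceType.
Implicit Types (a b : letter X) (u v w : seq (letter X)).

Definition push a w : seq (letter X) :=
  if w is b :: w' then if b == inv_letter a then w' else a :: w else [:: a].

Definition reduce w : seq (letter X) := foldr push [::] w.

Definition inv_word w : seq (letter X) := rev (map (@inv_letter X) w).

Lemma inv_letterK : involutive (@inv_letter X).
Proof. by case=> x b; rewrite /inv_letter negbK. Qed.

Lemma push_reduced a w : reduced w -> reduced (push a w).
Proof.
case: w => [//|b w] /=; case: ifPn => [_ /path_sorted //|nab].
by rewrite /reduced /= nab.
Qed.

Lemma pushK a w : reduced w -> push a (push (inv_letter a) w) = w.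
Proof.
case: w => [|b w] /=; first by rewrite eqxx.
rewrite inv_letterK; case: eqP => [->|_ _]; last by rewrite /= eqxx.
by case: w => [//|c w] /= /andP[/negPf ->].
Qed.

Lemma foldr_push_reduced u w : reduced w -> reduced (foldr push w u).
Proof. by move=> rw; elim: u => //= a u; apply: push_reduced. Qed.

Lemma reduce_reduced w : reduced (reduce w).
Proof. exact: foldr_push_reduced. Qed.

Lemma reduce_id w : reduced w -> reduce w = w.
Proof.
elim: w => //= a w IHw rw; rewrite (IHw (path_sorted rw)).
by case: w rw {IHw} => [|b w] //= /andP[/negPf ->].
Qed.

Lemma foldr_push_push a u w :
  reduced w -> foldr push w (push a u) = push a (foldr push w u).
Proof.
move=> rw; case: u => //= b u; case: eqP => [->|//].
by rewrite pushK ?foldr_push_reduced.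
Qed.

Lemma foldr_push_reduce u w :
  reduced w -> foldr push w (reduce u) = foldr push w u.
Proof. by move=> rw; elim: u => //= a u <-; rewrite foldr_push_push. Qed.

Definition fg_one : freegroup X := @FreeGroup X [::] isT.
Definition fg_mul (x y : freegroup X) : freegroup X :=
  @FreeGroup X (reduce (val x ++ val y)) (reduce_reduced _).
Definition fg_inv (x : freegroup X) : freegroup X :=
  @FreeGroup X (reduce (inv_word (val x))) (reduce_reduced _).

Lemma val_fg_mul x y : val (fg_mul x y) = foldr push (val y) (val x).
Proof. by rewrite /= /reduce foldr_cat [foldr _ _ (val y)]reduce_id ?(valP y). Qed.

Lemma fg_mulA : associative fg_mul.
Proof.
move=> x y z; apply: val_inj; rewrite (val_fg_mul x (fg_mul y z)).
rewrite (val_fg_mul y) (val_fg_mul (fg_mul x y)) -foldr_cat.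
exact/esym/foldr_push_reduce/(valP z).
Qed.

Lemma fg_mul1 : left_id fg_one fg_mul.
Proof. by move=> x; apply: val_inj; rewrite val_fg_mul. Qed.

Lemma fg_mulr1 : right_id fg_one fg_mul.
Proof. by move=> x; apply: val_inj; rewrite val_fg_mul [LHS]reduce_id ?(valP x). Qed.

Lemma foldr_push_inv_wordK u w :
  reduced w -> foldr push (foldr push w u) (inv_word u) = w.
Proof.
elim: u w => //= a u IHu w rw; rewrite /inv_word /= rev_cons foldr_rcons.
by rewrite -{2}[a]inv_letterK pushK ?foldr_push_reduced // IHu.
Qed.

Lemma fg_mulV : left_inverse fg_one fg_inv fg_mul.
Proof.
move=> x; apply: val_inj; rewrite val_fg_mul /=.
rewrite foldr_push_reduce ?(valP x) //.
have := @foldr_push_inv_wordK (val x) [::] isT.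
by rewrite -/(reduce _) reduce_id ?(valP x).
Qed.

Lemma fg_mulrV : right_inverse fg_one fg_inv fg_mul.
Proof.
move=> x; rewrite -[LHS]fg_mul1 -{1}(fg_mulV (fg_inv x)) -fg_mulA.
by rewrite [fg_mul (fg_inv x) _]fg_mulA fg_mulV fg_mul1 fg_mulV.
Qed.

HB.instance Definition _ := isGroup.Build (freegroup X)
  fg_mulA fg_mul1 fg_mulr1 fg_mulV fg_mulrV.

Definition fg_gen (x : X) : freegroup X := @FreeGroup X [:: (x, true)] isT.

Lemma val_fgM (x y : freegroup X) : val (x * y) = foldr push (val y) (val x).
Proof. exact: val_fg_mul. Qed.

Section UniversalProperty.
Variables (G : groupType) (h : X -> G).

Definition letter_value a : G := if a.2 then h a.1 else (h a.1)^-1.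

Definition fg_lift (x : freegroup X) : G := \prod_(a <- val x) letter_value a.

Lemma letter_valueV a : letter_value (inv_letter a) = (letter_value a)^-1.
Proof. by case: a => x [] //=; rewrite /letter_value /= invgK. Qed.

Lemma prod_push a w :
  \prod_(b <- push a w) letter_value b =
    letter_value a * \prod_(b <- w) letter_value b.
Proof.
case: w => [|b w] /=; first by rewrite big_cons.
by case: eqP => [->|_]; rewrite !big_cons // letter_valueV mulVKg.
Qed.

Lemma fg_lift_gen x : fg_lift (fg_gen x) = h x.
Proof. by rewrite /fg_lift big_cons big_nil mulg1. Qed.

Lemma fg_liftM : {morph fg_lift : x y / x * y}.
Proof.
move=> x y; rewrite /fg_lift val_fgM.
elim: (val x) => [|a w IHw] /=; first by rewrite big_nil mul1g.
by rewrite prod_push IHw big_cons mulgA.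
Qed.

Lemma fg_lift_unique (k : {multiplicative freegroup X -> G}) :
  (forall x, k (fg_gen x) = h x) -> k =1 fg_lift.
Proof.
move=> kh [w rw]; rewrite /fg_lift /=.
elim: w rw => [|a w IHw] rw.
  have -> : FreeGroup rw = 1 by apply: val_inj.
  by rewrite big_nil; apply: (mulgI (k 1)); rewrite -gmulfM !mulg1.
have ra : reduced [:: a] by [].
have rw' := path_sorted rw.
have -> : FreeGroup rw = FreeGroup ra * FreeGroup rw'.
  apply: val_inj; rewrite val_fgM /=.
  by case: (w) rw => [|b w'] //= /andP[/negPf ->].
rewrite gmulfM IHw big_cons; congr (_ * _).
have k1 : k 1 = 1 by apply: (mulgI (k 1)); rewrite -gmulfM !mulg1.
case: a ra {rw} => x [] ra; rewrite /letter_value /= -kh.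
  by congr (k _); apply: val_inj.
apply/esym/mulg1_eq; rewrite -gmulfM -k1; congr (k _).
by apply: val_inj; rewrite val_fgM /= /inv_letter /= eqxx.
Qed.

End UniversalProperty.

End FreeGroup.

Definition F2 : groupType := freegroup 'I_2.

Definition dpower (I : Type) (G : groupType) : Type := I -> G.
HB.instance Definition _ (I : Type) (G : groupType) := Choice.on (dpower I G).

Section DirectPower.
Variables (I : Type) (G : groupType).
Implicit Types x y z : dpower I G.

Definition dp_one : dpower I G := fun _ => 1.
Definition dp_mul x y : dpower I G := fun i => x i * y i.
Definition dp_inv x : dpower I G := fun i => (x i)^-1.

Lemma dp_mulA : associative dp_mul.
Proof. by move=> x y z; apply/funext => i; apply: mulgA. Qed.

Lemma dp_mul1 : left_id dp_one dp_mul.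
Proof. by move=> x; apply/funext => i; apply: mul1g. Qed.

Lemma dp_mulr1 : right_id dp_one dp_mul.
Proof. by move=> x; apply/funext => i; apply: mulg1. Qed.

Lemma dp_mulV : left_inverse dp_one dp_inv dp_mul.
Proof. by move=> x; apply/funext => i; apply: mulVg. Qed.

Lemma dp_mulrV : right_inverse dp_one dp_inv dp_mul.
Proof. by move=> x; apply/funext => i; apply: mulgV. Qed.

HB.instance Definition _ := isGroup.Build (dpower I G)
  dp_mulA dp_mul1 dp_mulr1 dp_mulV dp_mulrV.

End DirectPower.

Definition is_subgroup (G : groupType) (H : set G) : Prop :=
  [/\ H 1, (forall x y, H x -> H y -> H (x * y)) & (forall x, H x -> H x^-1)].

Definition derived_group (G : groupType) : set G :=
  smallest (@is_subgroup G) [set [~ x, y] | x in [set: G] & y in [set: G]].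
Arguments derived_group G : clear implicits.

Section Abelianization.
Variable G : groupType.
Implicit Types x y z : G.
Local Notation D := (derived_group G).

Lemma derived_group1 : D 1.
Proof. by move=> H [[]]. Qed.

Lemma derived_groupM x y : D x -> D y -> D (x * y).
Proof. by move=> Dx Dy H HP; case: (HP) => -[_ HM _] _; apply: HM; [apply: Dx|apply: Dy]. Qed.

Lemma derived_groupV x : D x -> D x^-1.
Proof. by move=> Dx H HP; case: (HP) => -[_ _ HV] _; apply: HV; apply: Dx. Qed.

Lemma derived_groupR x y : D [~ x, y].
Proof. by move=> H [_]; apply; exists x => //; exists y. Qed.

Lemma derived_groupJ x y : D x -> D (x ^ y).
Proof.
move=> Dx; have -> : x ^ y = x * [~ x, y] by rewrite /commg mulVKg.
by apply: derived_groupM => //; apply: derived_groupR.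
Qed.

Definition derived_eq : rel G := fun x y => `[< D (x^-1 * y) >].

Lemma derived_eq_refl : reflexive derived_eq.
Proof. by move=> x; apply/asboolP; rewrite mulVg; apply: derived_group1. Qed.

Lemma derived_eq_sym : symmetric derived_eq.
Proof.
move=> x y; apply/asboolP/asboolP => /derived_groupV; by rewrite invgM invgK.
Qed.

Lemma derived_eq_trans : transitive derived_eq.
Proof.
move=> y x z /asboolP xy /asboolP yz; apply/asboolP.
by have := derived_groupM xy yz; rewrite -mulgA mulVKg.
Qed.

Canonical derived_equiv :=
  EquivRel derived_eq derived_eq_refl derived_eq_sym derived_eq_trans.

Definition abelianization : Type := {eq_quot derived_eq}%qT.
HB.instance Definition _ := Choice.on abelianization.
HB.instance Definition _ := EqQuotient.on abelianization.

Local Notation pi := (\pi_abelianization)%qT.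

Lemma ab_piP x y : reflect (pi x = pi y) (derived_eq x y).
Proof. exact: eqquotP. Qed.

Definition ab_one : abelianization := pi 1.
Definition ab_mul (a b : abelianization) : abelianization := pi (repr a * repr b).
Definition ab_inv (a : abelianization) : abelianization := pi (repr a)^-1.

Lemma ab_repr x : D (x^-1 * repr (pi x)).
Proof. by apply/asboolP/ab_piP; rewrite reprK. Qed.

Lemma ab_piM x y : pi (x * y) = ab_mul (pi x) (pi y).
Proof.
apply/ab_piP/asboolP; rewrite invgM.
have -> : y^-1 * x^-1 * (repr (pi x) * repr (pi y)) =
  (x^-1 * repr (pi x)) ^ y * (y^-1 * repr (pi y)).
  by rewrite conjgE -!mulgA mulVKg.
by apply: derived_groupM; [apply: derived_groupJ|]; apply: ab_repr.
Qed.

Lemma ab_piV x : pi x^-1 = ab_inv (pi x).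
Proof.
apply/ab_piP/asboolP; rewrite invgK.
have -> : x * (repr (pi x))^-1 = ((x^-1 * repr (pi x))^-1) ^ (x^-1).
  by rewrite invgM invgK conjgE invgK -!mulgA mulgV mulg1.
by apply: derived_groupJ; apply: derived_groupV; apply: ab_repr.
Qed.

Lemma ab_ind (P : abelianization -> Prop) : (forall x, P (pi x)) -> forall a, P a.
Proof. by move=> HP a; rewrite -[a]reprK; apply: HP. Qed.

Lemma ab_mulA : associative ab_mul.
Proof.
elim/ab_ind=> x; elim/ab_ind=> y; elim/ab_ind=> z.
by rewrite -!ab_piM mulgA.
Qed.

Lemma ab_mul1 : left_id ab_one ab_mul.
Proof. by elim/ab_ind=> x; rewrite -ab_piM mul1g. Qed.

Lemma ab_mulr1 : right_id ab_one ab_mul.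
Proof. by elim/ab_ind=> x; rewrite -ab_piM mulg1. Qed.

Lemma ab_mulV : left_inverse ab_one ab_inv ab_mul.
Proof. by elim/ab_ind=> x; rewrite -ab_piV -ab_piM mulVg. Qed.

Lemma ab_mulrV : right_inverse ab_one ab_inv ab_mul.
Proof. by elim/ab_ind=> x; rewrite -ab_piV -ab_piM mulgV. Qed.

HB.instance Definition _ := isGroup.Build abelianization
  ab_mulA ab_mul1 ab_mulr1 ab_mulV ab_mulrV.

End Abelianization.

Definition torsion_free (G : groupType) : Prop :=
  forall (x : G) (n : nat), (0 < n)%N -> x ^+ n = 1 -> x = 1.

Definition commutator_lengths (G : groupType) (z : G) : set nat :=
  [set N | exists x y : 'I_N -> G, z = \prod_(i < N) [~ x i, y i]].

(* The minimum of the set when it is nonempty; outside the derived group the set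
   is empty and xget returns the dummy value 0. *)
Definition genus (G : groupType) (z : G) : nat :=
  if z == 1 then 0%N
  else xget 0%N (commutator_lengths z `&` lbound (commutator_lengths z)).

Definition root_genera (g n : nat) : set nat :=
  [set genus z | z in [set z : F2 | derived_group F2 z /\ (genus (z ^+ n) <= g)%N]].

(* The value in nat + {oo}: None stands for oo, and Some k for the finite value k,
   the maximum of a bounded set (which is nonempty, as it contains genus 1). *)
Definition max_root_genus (g n : nat) : option nat :=
  if `[< has_ubound (root_genera g n) >]
  then Some (xget 0%N (root_genera g n `&` ubound (root_genera g n)))
  else None.

Inductive term : Type :=
| Var of nat
| One
| Inv of term
| Mul of term & term.

Inductive formula : Type :=
| Equal of term & term
| Not of formula
| And of formula & formula
| Or of formula & formula
| Imp of formula & formula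
| All of nat & formula
| Ex of nat & formula.

(* baseGroupType carries *, ^-1 and 1 without any axiom: its instances are exactly
   the structures of the language. *)
Section Semantics.
Variable M : baseGroupType.

Fixpoint eval (e : nat -> M) (t : term) : M :=
  match t with
  | Var i => e i
  | One => 1
  | Inv t1 => (eval e t1)^-1
  | Mul t1 t2 => eval e t1 * eval e t2
  end.

Fixpoint holds (e : nat -> M) (p : formula) : Prop :=
  match p with
  | Equal t1 t2 => eval e t1 = eval e t2
  | Not q => ~ holds e q
  | And q r => holds e q /\ holds e r
  | Or q r => holds e q \/ holds e r
  | Imp q r => holds e q -> holds e r
  | All i q => forall a : M, holds [eta e with i |-> a] q
  | Ex i q => exists a : M, holds [eta e with i |-> a] q
  end.

Definition models (p : formula) : Prop := forall e : nat -> M, holds e p.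

End Semantics.

Fixpoint term_vars (t : term) : seq nat :=
  match t with
  | Var i => [:: i]
  | One => [::]
  | Inv t1 => term_vars t1
  | Mul t1 t2 => term_vars t1 ++ term_vars t2
  end.

Fixpoint free_vars (p : formula) : seq nat :=
  match p with
  | Equal t1 t2 => term_vars t1 ++ term_vars t2
  | Not q => free_vars q
  | And q r | Or q r | Imp q r => free_vars q ++ free_vars r
  | All i q | Ex i q => [seq j <- free_vars q | j != i]
  end.

Fixpoint quantifier_free (p : formula) : bool :=
  match p with
  | Equal _ _ => true
  | Not q => quantifier_free q
  | And q r | Or q r | Imp q r => quantifier_free q && quantifier_free r
  | All _ _ | Ex _ _ => false
  end.

Definition sentence (p : formula) : Prop := free_vars p = [::].

Definition logically_equivalent (p q : formula) : Prop :=
  forall M : baseGroupType, models M p <-> models M q.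

Definition Pi2_sentence (p : formula) : Prop :=
  sentence p /\
  exists (xs ys : seq nat) (psi : formula),
    [/\ uniq (xs ++ ys), quantifier_free psi,
        {subset free_vars psi <= xs ++ ys}
      & logically_equivalent p (foldr All (foldr Ex psi ys) xs)].

Definition almost_locally_free (G : groupType) : Prop :=
  forall p : formula, Pi2_sentence p -> models F2 p -> models G p.

(* Main.v *)
Require Import Defs.
From HB Require Import structures.
From mathcomp Require Import all_boot all_order ssralg ssrnum ssrint zify.
From mathcomp Require Import boolp classical_sets filter.

(** All three conditions say that F_2 has bounded roots ([bounded_roots]): for all
    positive g and n there is an N such that every z whose n-th power is a product of
    g commutators is itself a product of N commutators.

    For condition (1) this is a matter of unfolding the genus, except that the genus
    is only considered on the derived group: an n-th root of an element of [F_2, F_2]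
    must lie in [F_2, F_2], because the exponent sums of the generators detect the
    derived group of a free group ([torsion_free_abelianization_freegroup]).

    A group with bounded roots has torsion free abelianization, and the property passes
    from F_2 to its direct powers, where products of N commutators can be formed
    coordinatewise because N is uniform, and to almost locally free groups, because
    for given g, n and N it is expressed by a Pi2-sentence
    ([models_root_sentence]). Thus (1) implies (2) and (3).

    Conversely, suppose that the roots for some g and n are unbounded, and collect
    into a sequence z roots such that the k-th one is not a product of k commutators.
    The n-th power of z is a product of g commutators, but z is not in the derived
    group of F_2^omega, nor is its class in the derived group of the ultrapower of F_2
    by a nonprincipal ultrafilter ([torsion_free_bounded_roots]). The former refutes
    (2). The ultrapower is elementarily equivalent to F_2 by the theorem of Los
    ([holds_ultrapower]), in particular almost locally free, so the latter refutes (3).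
    The direct power itself cannot serve here, as it is not almost locally free: F_2
    satisfies the universal sentence saying that commuting is a transitive relation on
    nontrivial elements, and the direct power does not. *)

Set Implicit Arguments.
Unset Strict Implicit.
Unset Printing Implicit Defensive.

Local Open Scope classical_set_scope.
Local Open Scope group_scope.

(** * Products of commutators *)

Section CommutatorProducts.
Variable G : groupType.
Implicit Types (x y z w : G) (M N : nat).

Lemma commutator_lengths0 z : commutator_lengths z 0 <-> z = 1.
Proof.
split=> [[x [y ->]]|->]; first by rewrite big_ord0.
by exists (fun=> 1), (fun=> 1); rewrite big_ord0.
Qed.

Lemma commutator_lengthsM x y M N :
  commutator_lengths x M -> commutator_lengths y N ->
  commutator_lengths (x * y) (M + N).
Proof.
move=> [a [b ->]] [c [d ->]].
exists (fun i => match split i with inl j => a j | inr j => c j end).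
exists (fun i => match split i with inl j => b j | inr j => d j end).
rewrite big_split_ord /=; congr (_ * _); apply: eq_bigr => j _.
  by rewrite (unsplitK (inl j)).
by rewrite (unsplitK (inr j)).
Qed.

Lemma commutator_lengthsR x y : commutator_lengths [~ x, y] 1%N.
Proof. by exists (fun=> x), (fun=> y); rewrite big_ord1. Qed.

Lemma commutator_lengthsS z N : commutator_lengths z N.+1 <->
  exists x y w, commutator_lengths w N /\ z = [~ x, y] * w.
Proof.
split=> [[x [y ->]]|[x [y [w [wN ->]]]]].
  rewrite big_ord_recl; eexists _, _, _; split; last by [].
  by exists (fun i => x (lift ord0 i)), (fun i => y (lift ord0 i)).
by rewrite -add1n; apply: commutator_lengthsM => //; apply: commutator_lengthsR.
Qed.

(** Products can be padded with trivial commutators [~ 1, 1]. *)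
Lemma commutator_lengths_le z M N :
  (M <= N)%N -> commutator_lengths z M -> commutator_lengths z N.
Proof.
move=> MN zM; rewrite -[z]mulg1 -(subnKC MN); apply: commutator_lengthsM => //.
by exists (fun=> 1), (fun=> 1); rewrite big1 // => i _; rewrite commg1.
Qed.

Lemma commutator_lengthsV z N :
  commutator_lengths z N -> commutator_lengths z^-1 N.
Proof.
elim: N z => [|N IHN] z.
  by move=> /commutator_lengths0 ->; rewrite invg1; apply/commutator_lengths0.
move=> /commutator_lengthsS[x [y [w [wN ->]]]]; rewrite invgM invgR -addn1.
by apply: commutator_lengthsM; [apply: IHN|apply: commutator_lengthsR].
Qed.

Lemma derived_groupP z :
  derived_group G z <-> exists N, commutator_lengths z N.
Proof.
split=> [Dz|[N]]; last first.
  elim: N z => [|N IHN] z.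
    by move=> /commutator_lengths0 ->; apply: derived_group1.
  move=> /commutator_lengthsS[x [y [w [wN ->]]]].
  by apply: derived_groupM; [apply: derived_groupR|apply: IHN].
apply: (Dz [set w | exists N, commutator_lengths w N]); split; last first.
  by move=> _ [x _ [y _ <-]]; exists 1%N; apply: commutator_lengthsR.
split; first by exists 0%N; apply/commutator_lengths0.
  move=> x y [M xM] [N yN]; exists (M + N)%N; exact: commutator_lengthsM.
by move=> x [N xN]; exists N; apply: commutator_lengthsV.
Qed.

(** The genus is a minimum, and lengths are closed upwards by padding. *)
Lemma genus_le z N :
  derived_group G z -> (genus z <= N)%N <-> commutator_lengths z N.
Proof.
move=> /derived_groupP[K zK]; rewrite /genus; case: eqP => [->|_].
  split=> // _; apply: commutator_lengths_le (leq0n N) _.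
  exact/commutator_lengths0.
have ex : exists n, `[< commutator_lengths z n >] by exists K; apply/asboolP.
have /(xgetPex 0%N)[]:
    exists m, (commutator_lengths z `&` lbound (commutator_lengths z)) m.
  have [m /asboolP zm min] := ex_minnP ex; exists m; split=> // k zk.
  by rewrite leEnat; apply: min; apply/asboolP.
set m := xget _ _ => zm min; split=> [le|zN].
  exact: commutator_lengths_le zm.
by rewrite -leEnat; apply: min.
Qed.

End CommutatorProducts.

Section Morphisms.
Variables (G H : groupType) (f : UMagmaMorphism.type G H).

Lemma commutator_lengths_morph z N :
  commutator_lengths z N -> commutator_lengths (f z) N.
Proof.
move=> [x [y ->]]; exists (f \o x), (f \o y).
by rewrite gmulf_prod; apply: eq_bigr => i _; rewrite gmulfR.
Qed.

Lemma commutator_lengths_lift w N : (forall y, exists x, f x = y) ->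
  commutator_lengths w N -> exists2 z, f z = w & commutator_lengths z N.
Proof.
move=> /choice[s fs] [x [y ->]].
exists (\prod_(i < N) [~ s (x i), s (y i)]); last first.
  by exists (s \o x), (s \o y).
by rewrite gmulf_prod; apply: eq_bigr => i _; rewrite gmulfR /= !fs.
Qed.

End Morphisms.

(** Naming the coordinate projections makes them available as group morphisms. *)
Definition dp_eval (I : Type) (G : groupType) (i : I) (x : dpower I G) : G := x i.

Lemma dp_eval_morphism (I : Type) (G : groupType) (i : I) :
  monoid_morphism (@dp_eval I G i).
Proof. by []. Qed.
HB.instance Definition _ (I : Type) (G : groupType) (i : I) :=
  isUMagmaMorphism.Build (dpower I G) G (@dp_eval I G i)
    (@dp_eval_morphism I G i).

Lemma dpowerX (I : Type) (G : groupType) (z : dpower I G) n i :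
  (z ^+ n : dpower I G) i = z i ^+ n.
Proof. exact: (gmulfXn (@dp_eval I G i)). Qed.

(** Entries for the coordinates can be chosen independently, since all coordinates
    are products of the same number of commutators. *)
Lemma commutator_lengths_dpower (I : Type) (G : groupType) (z : dpower I G) N :
  commutator_lengths z N <-> forall i, commutator_lengths (z i) N.
Proof.
split=> [zN i|]; first exact: (commutator_lengths_morph (@dp_eval I G i)).
elim: N z => [|N IHN] z zN.
  by apply/commutator_lengths0/funext => i; apply/commutator_lengths0.
have /choice[x] : forall i, exists p : G * G * G,
    commutator_lengths p.2 N /\ z i = [~ p.1.1, p.1.2] * p.2.
  move=> i; have /commutator_lengthsS[x [y [w h]]] := zN i.
  by exists (x, y, w).
move=> /all_and2[xN zE]; apply/commutator_lengthsS.
exists (fun i => (x i).1.1), (fun i => (x i).1.2), (fun i => (x i).2).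
by split; [apply: IHN|apply/funext].
Qed.

Section AbelianizationMap.
Variable G : groupType.

Definition to_abelianization (x : G) : abelianization G :=
  (\pi_(abelianization G) x)%qT.

Lemma to_abelianization_morphism : monoid_morphism to_abelianization.
Proof. by split=> // x y; apply: ab_piM. Qed.
HB.instance Definition _ :=
  isUMagmaMorphism.Build G (abelianization G) to_abelianization
    to_abelianization_morphism.

Lemma to_abelianization_eq1 x :
  to_abelianization x = 1 <-> derived_group G x.
Proof.
have <- : to_abelianization 1 = 1 by [].
split=> [/ab_piP/asboolP|Dx].
  by rewrite mulg1 => /derived_groupV; rewrite invgK.
by apply/ab_piP/asboolP; rewrite mulg1; apply: derived_groupV.
Qed.

Lemma torsion_free_abelianizationP : torsion_free (abelianization G) <->
  forall (x : G) n, (0 < n)%N -> derived_group G (x ^+ n) -> derived_group G x.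
Proof.
have XE x n : to_abelianization x ^+ n = to_abelianization (x ^+ n).
  by rewrite gmulfXn.
split=> tf x n n0.
  move=> /to_abelianization_eq1; rewrite -XE.
  by move=> /(tf _ _ n0)/to_abelianization_eq1.
elim/ab_ind: x => x; rewrite -[(\pi_(_) _)%qT]/(to_abelianization x) XE.
by move=> /to_abelianization_eq1/(tf _ _ n0)/to_abelianization_eq1.
Qed.

End AbelianizationMap.

(** * Free groups have torsion free abelianization *)

Section ExponentSums.
Variable X : choiceType.
Implicit Types (a b : letter X) (w : seq (letter X)).

(** The total exponent of a generator, counted with a sign depending on the letter
    chosen for it: the coordinates of the map to the free abelian group on [X]. *)
Definition exponent_sum a w : int :=
  ((count_mem a w)%:Z - (count_mem (inv_letter a) w)%:Z)%R.

Lemma exponent_sum_push a b w :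
  exponent_sum a (push b w) = (exponent_sum a [:: b] + exponent_sum a w)%R.
Proof.
rewrite /exponent_sum; case: w => [|c w] /=; first by lia.
case: eqP => [->|_] /=; last by lia.
rewrite (can_eq (@inv_letterK X)) -(can_eq (@inv_letterK X) (inv_letter b)).
rewrite inv_letterK; lia.
Qed.

Lemma exponent_sumM a (x y : freegroup X) :
  exponent_sum a (val (x * y)) =
  (exponent_sum a (val x) + exponent_sum a (val y))%R.
Proof.
have cons b w : exponent_sum a (b :: w) =
    (exponent_sum a [:: b] + exponent_sum a w)%R.
  by rewrite /exponent_sum /=; lia.
rewrite val_fgM; elim: (val x) => [|b w IHw] /=; first by rewrite GRing.add0r.
by rewrite exponent_sum_push IHw [in RHS]cons GRing.addrA.
Qed.

Lemma exponent_sumX a (x : freegroup X) n :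
  exponent_sum a (val (x ^+ n)) = (exponent_sum a (val x) *+ n)%R.
Proof.
elim: n => [|n IHn]; first by rewrite expg0 GRing.mulr0n.
by rewrite expgS exponent_sumM IHn GRing.mulrS.
Qed.

Lemma exponent_sum_derived a (x : freegroup X) :
  derived_group (freegroup X) x -> exponent_sum a (val x) = 0%R.
Proof.
have V (y : freegroup X) : exponent_sum a (val y^-1) = (- exponent_sum a (val y))%R.
  have := exponent_sumM a y^-1 y; rewrite mulVg.
  by rewrite [in LHS]/exponent_sum /=; lia.
move=> Dx; apply: (Dx [set y | exponent_sum a (val y) = 0%R]); split.
  split=> // [y z|y]; rewrite /mkset; last by rewrite V => ->.
  by rewrite exponent_sumM => -> ->.
move=> _ [y _ [z _ <-]]; rewrite /mkset commgEl conjgE.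
by rewrite !exponent_sumM !V; lia.
Qed.

(** A first letter [a] of a balanced word is matched by some later [a^-1]; as
    [a u a^-1] and [u] differ by a commutator, both letters can be deleted without
    leaving the coset of the derived group, and the word stays balanced. *)
Lemma derived_balanced w : (forall a, exponent_sum a w = 0%R) ->
  derived_group (freegroup X) (\prod_(a <- w) letter_value (@fg_gen X) a).
Proof.
have [n] := ubnP (size w); elim: n w => // n IHn [|a w] /= szw bal.
  by rewrite big_nil; apply: derived_group1.
have aw : inv_letter a \in w.
  rewrite -has_pred1 has_count; have := bal a; rewrite /exponent_sum /= eqxx.
  have -> : (a == inv_letter a) = false.
    by case: (a) => x []; rewrite xpair_eqE andbF.
  by rewrite add0n; lia.
case/splitPr: aw szw bal => u v szw bal.
rewrite big_cons big_cat big_cons letter_valueV /=.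
set g := letter_value _ a; set p := \prod_(_ <- u) _; set q := \prod_(_ <- v) _.
have -> : g * (p * (g^-1 * q)) = [~ g^-1, p^-1] * (p * q).
  by rewrite commgEl conjgE !invgK !mulgA mulgVK.
apply: derived_groupM; first exact: derived_groupR.
rewrite -big_cat; apply: IHn => [|b].
  by move: szw; rewrite !size_cat /=; lia.
have := bal b; rewrite /exponent_sum /= !count_cat /=.
rewrite (can_eq (@inv_letterK X)) -(can_eq (@inv_letterK X) (inv_letter a) b).
rewrite inv_letterK; lia.
Qed.

Lemma exponent_sum_eq0 (x : freegroup X) :
  (forall a, exponent_sum a (val x) = 0%R) -> derived_group (freegroup X) x.
Proof.
have liftE : fg_lift (@fg_gen X) x = x.
  by rewrite -(fg_lift_unique (k := idfun)).
by move=> /derived_balanced; rewrite -/(fg_lift (@fg_gen X) x) liftE.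
Qed.

End ExponentSums.

(** Membership in the derived group is the vanishing of integer-valued
    homomorphisms, a condition insensitive to taking roots. *)
Lemma torsion_free_abelianization_freegroup (X : choiceType) :
  torsion_free (abelianization (freegroup X)).
Proof.
apply/torsion_free_abelianizationP => x n n0 Dxn.
apply: exponent_sum_eq0 => a; have := exponent_sum_derived a Dxn.
by rewrite exponent_sumX => /eqP; rewrite Num.Theory.mulrn_eq0;
  case: n n0 {Dxn} => //= n _ /eqP.
Qed.

(** * Roots of products of commutators *)

(** Torsion freeness of the abelianization with a uniform bound, depending only on
    [g] and [n], on the number of commutators needed for the root. *)
Definition bounded_roots (G : groupType) : Prop := forall g n : nat, (0 < n)%N ->
  exists N, forall z : G, commutator_lengths (z ^+ n) g -> commutator_lengths z N.

Lemma max_root_genus_neq_None g n :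
  max_root_genus g n <> None <-> has_ubound (root_genera g n).
Proof. by rewrite /max_root_genus; case: asboolP. Qed.

(** The genus, and hence [max_root_genus], speaks about elements of the derived group
    only. That a root of an element of the derived group of F_2 lies there as well is
    what the torsion freeness of the abelianization of F_2 provides. *)
Lemma bounded_roots_F2 :
  (forall g n : nat, (0 < g)%N -> (0 < n)%N -> max_root_genus g n <> None) <->
  bounded_roots F2.
Proof.
have derivedX (z : F2) n : derived_group F2 z -> derived_group F2 (z ^+ n).
  move=> Dz; elim: n => [|n IHn]; first exact: derived_group1.
  by rewrite expgS; apply: derived_groupM.
split=> bnd g n.
  move=> n0; have /max_root_genus_neq_None[N ubN] := bnd g.+1 n isT n0.
  exists N => z zng; have Dzn : derived_group F2 (z ^+ n).
    by apply/derived_groupP; exists g.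
  have Dz := (torsion_free_abelianizationP F2).1
    (@torsion_free_abelianization_freegroup _) _ _ n0 Dzn.
  apply/genus_le => //; rewrite -leEnat; apply: ubN; exists z => //; split=> //.
  by apply/genus_le => //; apply: commutator_lengths_le zng.
move=> _ n0; apply/max_root_genus_neq_None; have [N hN] := bnd g n n0.
exists N => _ [z [Dz zng] <-]; rewrite leEnat; apply/genus_le => //.
by apply: hN; apply/genus_le => //; apply: derivedX.
Qed.

Lemma bounded_roots_torsion_free (G : groupType) :
  bounded_roots G -> torsion_free (abelianization G).
Proof.
move=> bnd; apply/torsion_free_abelianizationP => x n n0 /derived_groupP[g xng].
by have [N hN] := bnd g n n0; apply/derived_groupP; exists N; apply: hN.
Qed.

Lemma bounded_roots_dpower (I : Type) (G : groupType) :
  bounded_roots G -> bounded_roots (dpower I G).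
Proof.
move=> bnd g n n0; have [N hN] := bnd g n n0; exists N => z.
move=> /commutator_lengths_dpower zng; apply/commutator_lengths_dpower => i.
by apply: hN; have := zng i; rewrite dpowerX.
Qed.

(** Suppose that no bound works for (g, n), and let [z k] be a root that is not a
    product of [k] commutators. Then [q z] has its n-th power in the derived group,
    hence lies there itself and is the image of a sequence [w] of products of [N]
    commutators, for one [N]. Equality of [q z] and [q w] forces [z k = w k] for some
    k >= N, which contradicts the choice of [z k]. The identity map and the projection
    onto a nonprincipal ultrapower are the quotient maps of interest. *)
Lemma torsion_free_bounded_roots (G Q : groupType)
    (q : UMagmaMorphism.type (dpower nat G) Q) :
  (forall y, exists x, q x = y) ->
  (forall x y, q x = q y -> forall m, exists2 k, (m <= k)%N & x k = y k) ->
  torsion_free (abelianization Q) -> bounded_roots G.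
Proof.
move=> q_surj q_inj /torsion_free_abelianizationP tf g n n0; apply: contrapT.
move=> /forallNP nbnd.
have /choice[z] : forall k, exists z : G,
    commutator_lengths (z ^+ n) g /\ ~ commutator_lengths z k.
  by move=> k; have /existsNP[z /not_implyP] := nbnd k; exists z.
move=> /all_and2[zng zk].
have : commutator_lengths ((z : dpower nat G) ^+ n) g.
  apply/commutator_lengths_dpower => k.
  by rewrite dpowerX.
move=> /(commutator_lengths_morph q); rewrite gmulfXn => qzng.
have /derived_groupP[N] : derived_group Q (q z).
  by apply: tf n0 _; apply/derived_groupP; exists g.
move=> /(commutator_lengths_lift q_surj)[w qw /commutator_lengths_dpower wN].
have [k Nk wk] := q_inj _ _ qw N.
by apply: (zk k); apply: commutator_lengths_le Nk _; rewrite -wk.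
Qed.

(** * Pi2-sentences bounding the roots of products of commutators *)

Section PrenexSemantics.
Variable M : baseGroupType.
Implicit Types (e : nat -> M) (p q : formula) (xs : seq nat).

Lemma update_id e i : [eta e with i |-> e i] = e :> (nat -> M).
Proof. by apply/funext => j /=; case: eqP => [->|]. Qed.

Lemma models_foldr_All q xs : models M (foldr All q xs) <-> models M q.
Proof.
elim: xs => //= i xs IHxs; split=> [h|/IHxs h e a]; last exact: h.
by apply/IHxs => e; rewrite -(update_id e i); apply: h.
Qed.

Lemma holds_foldr_Ex q xs e : holds e (foldr Ex q xs) <->
  exists2 e', {in [predC xs], e' =1 e} & holds e' q.
Proof.
elim: xs e => [|i xs IHxs] e /=.
  split=> [qe|[e' ee' qe']]; first by exists e.
  by have <- : e' = e by apply/funext => j; apply: ee'.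
split=> [[a /IHxs[e' ee' qe']]|[e' ee' qe']].
  exists e' => // j; rewrite !inE negb_or => /andP[ji jxs].
  by rewrite ee' //= (negPf ji).
exists (e' i); apply/IHxs; exists e' => // j jxs /=.
by case: eqP => [->//|/eqP ji]; rewrite ee' // !inE negb_or ji.
Qed.

Lemma eval_ext t e e' : {in term_vars t, e =1 e'} -> eval e t = eval e' t.
Proof.
elim: t => //= [i|t IHt|t IHt u IHu] ee'; first by rewrite ee' ?inE.
  by rewrite IHt.
by rewrite IHt ?IHu // => i it; apply: ee'; rewrite mem_cat it ?orbT.
Qed.

End PrenexSemantics.

Lemma free_vars_foldr_All q xs :
  free_vars (foldr All q xs) = [seq j <- free_vars q | j \notin xs].
Proof.
elim: xs => /= [|i xs ->]; first by rewrite filter_predT.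
by rewrite -filter_predI; apply: eq_filter => j; rewrite /= !inE negb_or.
Qed.

Lemma free_vars_foldr_Ex q xs :
  free_vars (foldr Ex q xs) = [seq j <- free_vars q | j \notin xs].
Proof.
elim: xs => /= [|i xs ->]; first by rewrite filter_predT.
by rewrite -filter_predI; apply: eq_filter => j; rewrite /= !inE negb_or.
Qed.

Fixpoint exp_term (t : term) (n : nat) : term :=
  if n is n'.+1 then Mul t (exp_term t n') else One.

Definition commutator_term (t u : term) : term :=
  Mul (Inv t) (Mul (Inv u) (Mul t u)).

(** The product of [N] commutators whose entries are the distinct variables
    [m, m + 1, ..., m + 2N - 1], so that its value ranges over all such products. *)
Fixpoint commutators_term (m N : nat) : term :=
  if N is N'.+1
  then Mul (commutator_term (Var m) (Var m.+1)) (commutators_term m.+2 N')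
  else One.

Lemma term_vars_commutators m N :
  {subset term_vars (commutators_term m N) <= iota m N.*2}.
Proof.
elim: N m => //= N IHN m i.
have := IHN m.+2 i; rewrite !inE !mem_iota.
by case: (_ \in _) => [/(_ isT)|_]; lia.
Qed.

Section CommutatorTerms.
Variable G : groupType.
Implicit Types (e : nat -> G).

Lemma eval_exp_term e t n : eval e (exp_term t n) = eval e t ^+ n.
Proof. by elim: n => //= n ->; rewrite expgS. Qed.

Lemma eval_commutators_term e m N :
  commutator_lengths (eval e (commutators_term m N)) N.
Proof.
elim: N m => [|N IHN] m /=; first exact/commutator_lengths0.
apply/commutator_lengthsS.
by exists (e m), (e m.+1), (eval e (commutators_term m.+2 N)).
Qed.

Lemma commutator_lengths_eval e m N z : commutator_lengths z N ->
  exists2 e', {in [predC iota m N.*2], e' =1 e} &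
    eval e' (commutators_term m N) = z.
Proof.
elim: N m z => [|N IHN] m z; first by move=> /commutator_lengths0 ->; exists e.
move=> /commutator_lengthsS[x [y [w [wN ->]]]].
have [e' ee' e'w] := IHN m.+2 _ wN.
exists [eta e' with m |-> x, m.+1 |-> y] => [j|].
  rewrite /= !inE !negb_or => /and3P[jm jm1 j_iota].
  by rewrite (negPf jm) (negPf jm1) ee'.
rewrite /= !eqxx (gtn_eqF (ltnSn m)) commgEl conjgE; congr (_ * _).
rewrite -e'w; apply: eval_ext => j /term_vars_commutators.
by rewrite mem_iota /= => /andP[mj _]; rewrite !gtn_eqF // ltnW.
Qed.

End CommutatorTerms.

Section RootSentence.
Variables g n N : nat.

(** Variable 0 is the root, variables 1, ..., 2g are the entries of the product that
    its n-th power equals, and the next 2N are those of the product sought. *)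
Definition root_matrix : formula :=
  Imp (Equal (exp_term (Var 0) n) (commutators_term 1 g))
      (Equal (Var 0) (commutators_term g.*2.+1 N)).

Definition root_sentence : formula :=
  foldr All (foldr Ex root_matrix (iota g.*2.+1 N.*2)) (iota 0 g.*2.+1).

Lemma free_vars_root_matrix :
  {subset free_vars root_matrix <= iota 0 g.*2.+1 ++ iota g.*2.+1 N.*2}.
Proof.
have exp_vars i : i \in term_vars (exp_term (Var 0) n) -> i = 0%N.
  by elim: (n) => //= k IHk; rewrite inE => /predU1P[].
rewrite -iotaD => i; rewrite mem_iota /= mem_cat inE mem_cat.
move=> /orP[/orP[/exp_vars ->//|]|/predU1P[->//|]].
  by move=> /term_vars_commutators; rewrite mem_iota; lia.
by move=> /term_vars_commutators; rewrite mem_iota; lia.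
Qed.

Lemma Pi2_root_sentence : Pi2_sentence root_sentence.
Proof.
split.
  rewrite /sentence free_vars_foldr_All free_vars_foldr_Ex -filter_predI.
  apply/eqP; rewrite -(negbK (_ == _)) -has_filter; apply/hasPn => i.
  by move=> /free_vars_root_matrix; rewrite mem_cat /= -negb_or negbK.
exists (iota 0 g.*2.+1), (iota g.*2.+1 N.*2), root_matrix; split=> //.
- by rewrite -iotaD iota_uniq.
- exact: free_vars_root_matrix.
Qed.

Lemma models_root_sentence (G : groupType) : models G root_sentence <->
  forall z : G, commutator_lengths (z ^+ n) g -> commutator_lengths z N.
Proof.
split=> [/models_foldr_All h z zng|h].
  have [e e0 ez] := commutator_lengths_eval (fun=> z) 1 zng.
  have e0z : e 0%N = z by rewrite e0 // inE mem_iota.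
  have /holds_foldr_Ex[e' ee' /=] := h e.
  have e'e i : (i <= g.*2)%N -> e' i = e i.
    by move=> ig; rewrite ee' // inE mem_iota; lia.
  rewrite eval_exp_term /= e'e // e0z => e'z; rewrite e'z.
    exact: eval_commutators_term.
  rewrite -ez; apply/esym/eval_ext => i /term_vars_commutators.
  by rewrite mem_iota => ig; rewrite e'e //; lia.
apply/models_foldr_All => e; apply/holds_foldr_Ex.
have [e0g|ne0g] := EM (e 0%N ^+ n = eval e (commutators_term 1 g)); last first.
  by exists e => //=; rewrite eval_exp_term.
have [|e' e'e e'0] := commutator_lengths_eval e g.*2.+1 (h (e 0%N) _).
  by rewrite e0g; apply: eval_commutators_term.
exists e' => //= _; rewrite e'0 e'e // inE mem_iota.
by lia.
Qed.

End RootSentence.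

(** For each (g, n) a bound [N] valid in F_2 is asserted by a single Pi2-sentence,
    hence the same [N] works in every almost locally free group. *)
Lemma almost_locally_free_bounded_roots (G : groupType) :
  bounded_roots F2 -> almost_locally_free G -> bounded_roots G.
Proof.
move=> bnd alf g n n0; have [N hN] := bnd g n n0; exists N.
apply/models_root_sentence/alf; first exact: Pi2_root_sentence.
exact/models_root_sentence.
Qed.

(** * Ultrapowers *)

Section ReducedPower.
Variables (I : Type) (G : groupType) (F : set_system I).
Context {FF : Filter F}.
Implicit Types x y z : dpower I G.

Definition rp_eq : rel (dpower I G) := fun x y => `[< F [set i | x i = y i] >].

Lemma rp_eq_refl : reflexive rp_eq.
Proof. by move=> x; apply/asboolP; apply: filterE. Qed.

Lemma rp_eq_sym : symmetric rp_eq.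
Proof. by move=> x y; apply/asboolP/asboolP; apply: filterS => i /= ->. Qed.

Lemma rp_eq_trans : transitive rp_eq.
Proof.
move=> y x z /asboolP xy /asboolP yz; apply/asboolP.
by apply: filterS2 xy yz => i /= -> ->.
Qed.

Canonical rp_equiv := EquivRel rp_eq rp_eq_refl rp_eq_sym rp_eq_trans.

(** This is the ultrapower of [G] when [F] is an ultrafilter. *)
Definition reduced_power : Type := {eq_quot rp_eq}%qT.
HB.instance Definition _ := Choice.on reduced_power.
HB.instance Definition _ := EqQuotient.on reduced_power.

Definition rp_class x : reduced_power := (\pi_reduced_power x)%qT.

Lemma rp_classP x y : rp_class x = rp_class y <-> F [set i | x i = y i].
Proof.
split=> [/eqP|h]; first by rewrite eqmodE => /asboolP.
by apply/eqP; rewrite eqmodE; apply/asboolP.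
Qed.

Lemma rp_class_surj a : exists x, rp_class x = a.
Proof. by exists (repr a); rewrite /rp_class reprK. Qed.

Definition rp_one : reduced_power := rp_class 1.
Definition rp_mul (a b : reduced_power) := rp_class (repr a * repr b).
Definition rp_inv (a : reduced_power) := rp_class (repr a)^-1.

Lemma rp_repr x : F [set i | repr (rp_class x) i = x i].
Proof. by apply/rp_classP; rewrite /rp_class reprK. Qed.

Lemma rp_classM x y : rp_class (x * y) = rp_mul (rp_class x) (rp_class y).
Proof.
apply/rp_classP; apply: filterS2 (rp_repr x) (rp_repr y) => i /= xi yi.
by rewrite -[LHS]/(x i * y i) -xi -yi.
Qed.

Lemma rp_classV x : rp_class x^-1 = rp_inv (rp_class x).
Proof.
apply/rp_classP; apply: filterS (rp_repr x) => i /= xi.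
by rewrite -[LHS]/((x i)^-1) -xi.
Qed.

Lemma rp_ind (P : reduced_power -> Prop) :
  (forall x, P (rp_class x)) -> forall a, P a.
Proof. by move=> HP a; have [x <-] := rp_class_surj a. Qed.

Lemma rp_mulA : associative rp_mul.
Proof.
by elim/rp_ind=> x; elim/rp_ind=> y; elim/rp_ind=> z; rewrite -!rp_classM mulgA.
Qed.

Lemma rp_mul1 : left_id rp_one rp_mul.
Proof. by elim/rp_ind=> x; rewrite -rp_classM mul1g. Qed.

Lemma rp_mulr1 : right_id rp_one rp_mul.
Proof. by elim/rp_ind=> x; rewrite -rp_classM mulg1. Qed.

Lemma rp_mulV : left_inverse rp_one rp_inv rp_mul.
Proof. by elim/rp_ind=> x; rewrite -rp_classV -rp_classM mulVg. Qed.

Lemma rp_mulrV : right_inverse rp_one rp_inv rp_mul.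
Proof. by elim/rp_ind=> x; rewrite -rp_classV -rp_classM mulgV. Qed.

HB.instance Definition _ := isGroup.Build reduced_power
  rp_mulA rp_mul1 rp_mulr1 rp_mulV rp_mulrV.

Lemma rp_class_morphism : monoid_morphism rp_class.
Proof. by split=> // x y; apply: rp_classM. Qed.
HB.instance Definition _ :=
  isUMagmaMorphism.Build (dpower I G) reduced_power rp_class rp_class_morphism.

Lemma eval_rp_class (e : nat -> dpower I G) t :
  eval (fun j => rp_class (e j)) t = rp_class (fun i => eval (e^~ i) t).
Proof.
elim: t => //= [t ->|t -> u ->]; first by rewrite -[LHS]rp_classV.
by rewrite -[LHS]rp_classM.
Qed.

End ReducedPower.
Arguments reduced_power {I} G F {FF}.
Arguments rp_class {I G F FF}.

Section Ultrapower.
Variables (I : Type) (G : groupType) (U : set_system I).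
Context {UU : UltraFilter U}.
Local Notation Q := (reduced_power G U).

Lemma ultra_setC (A : set I) : U (~` A) <-> ~ U A.
Proof.
split=> [UC UA|nUA]; last by have [] := in_ultra_setVsetC A UU.
suff /filter_ex[] : U set0 by [].
by rewrite -(setICr A); apply: filterI.
Qed.

Lemma holds_update_rp_class (p : formula) (e : nat -> dpower I G) j x :
  (forall e', holds (fun k => rp_class (e' k) : Q) p <->
              U [set i | holds (e'^~ i) p]) ->
  holds [eta (fun k => rp_class (e k) : Q) with j |-> rp_class x] p <->
  U [set i | holds [eta e^~ i with j |-> x i] p].
Proof.
have -> : [eta (fun k => rp_class (e k) : Q) with j |-> rp_class x] =
    (fun k => rp_class ([eta e with j |-> x] k)) :> (nat -> Q).
  by apply/funext => k /=; case: eqP.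
move=> ->; under [in X in X <-> _]eq_set => i.
  have -> : (fun k => [eta e with j |-> x] k i) =
      [eta e^~ i with j |-> x i] :> (nat -> G).
    by apply/funext => k /=; case: eqP.
  over.
by [].
Qed.

Lemma choice_witness (P : I -> G -> Prop) :
  exists x : dpower I G, forall i, (exists a, P i a) -> P i (x i).
Proof.
suff /choice[x xP] : forall i, exists a, (exists b, P i b) -> P i a by exists x.
move=> i; have [[a Pa]|nP] := EM (exists b, P i b); [by exists a|by exists 1].
Qed.

(** Every subformula is decided coordinatewise: that [U] is a filter handles
    conjunctions, that it is an ultrafilter handles negations, and an existential
    quantifier is handled by choosing a witness in each coordinate that has one.
    A universal quantifier is treated dually, by choosing counterexamples. *)
Lemma holds_ultrapower (p : formula) (e : nat -> dpower I G) :
  holds (fun j => rp_class (e j) : Q) p <-> U [set i | holds (e^~ i) p].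
Proof.
elim: p e => /= [t u|p IHp|p IHp q IHq|p IHp q IHq|p IHp q IHq|j p IHp|j p IHp] e.
- by rewrite !eval_rp_class; apply: rp_classP.
- by rewrite IHp; apply: iff_sym; apply: ultra_setC.
- rewrite IHp IHq; split=> [[Up Uq]|Upq]; first exact: filterI.
  by split; apply: filterS Upq => i [].
- rewrite IHp IHq; split=> [[]|]; [by apply: filterS; left|by apply: filterS; right|].
  have [Up _|/ultra_setC nUp Upq] := EM (U [set i | holds (e^~ i) p]).
    by left.
  by right; apply: filterS2 Upq nUp => i /= [].
- rewrite IHp IHq; split=> [pq|Upq Up]; last by apply: filterS2 Upq Up => i; apply.
  have [/pq|/ultra_setC] := EM (U [set i | holds (e^~ i) p]);
    apply: filterS => i //=.
- split=> [h|h a]; last first.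
    have [x <-] := rp_class_surj a.
    by apply/holds_update_rp_class => //; apply: filterS h => i /=.
  have [x xP] := choice_witness (fun i a => ~ holds [eta e^~ i with j |-> a] p).
  have /(holds_update_rp_class _ _ _ IHp) := h (rp_class x).
  by apply: filterS => i /= pxi a; apply: contrapT => npa;
    apply: (xP i) => //; exists a.
- split=> [[a]|h].
    have [x <-] := rp_class_surj a.
    move=> /(holds_update_rp_class _ _ _ IHp); apply: filterS => i /= pxi.
    by exists (x i).
  have [x xP] := choice_witness (fun i a => holds [eta e^~ i with j |-> a] p).
  by exists (rp_class x); apply/holds_update_rp_class => //;
    apply: filterS h => i /= /xP.
Qed.

Lemma models_ultrapower p : models G p -> models Q p.
Proof.
move=> Gp e; have /choice[f fe] : forall j, exists x, rp_class x = e j.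
  by move=> j; apply: rp_class_surj.
by rewrite -(funext fe); apply/holds_ultrapower; apply: filterE => i; apply: Gp.
Qed.

End Ultrapower.

(** A nonprincipal ultrafilter contains the sets of integers above a given bound, so
    sequences with the same class agree at arbitrarily large indices. *)
Lemma ultrapower_bounded_roots (G : groupType) (U : set_system nat)
    {UU : UltraFilter U} :
  (\oo : set_system nat) `<=` U ->
  torsion_free (abelianization (reduced_power G U)) -> bounded_roots G.
Proof.
move=> ooU; apply: (@torsion_free_bounded_roots _ _
  (rp_class : dpower nat G -> reduced_power G U)).
  by move=> y; apply: rp_class_surj.
move=> x y /rp_classP xy m.
have Um : U [set k | (m <= k)%N] by apply: ooU; exists m.
suff /filter_ex[k [mk xk]] :
  U ([set k | (m <= k)%N] `&` [set k | x k = y k]) by exists k.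
exact: filterI.
Qed.

Theorem theorem16 :
  let S1 := forall g n : nat, 0 < g -> 0 < n -> max_root_genus g n <> None in
  let S2 := torsion_free (abelianization (dpower nat F2)) in
  let S3 := forall G : groupType,
    almost_locally_free G -> torsion_free (abelianization G) in
  (S1 <-> S2) /\ (S2 <-> S3) /\ (S1 <-> S3).
Proof.
move=> S1 S2 S3; have S1E : S1 <-> bounded_roots F2 := bounded_roots_F2.
have S12 : S1 <-> S2.
  rewrite S1E; split=> [bnd|].
    exact/bounded_roots_torsion_free/bounded_roots_dpower.
  apply: (@torsion_free_bounded_roots _ _ idfun) => [y|x y /= -> m].
    by exists y.
  by exists m.
have S13 : S1 <-> S3.
  rewrite S1E; split=> [bnd G /(almost_locally_free_bounded_roots bnd)|tf].
    exact: bounded_roots_torsion_free.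
  have [U [UU ooU]] := ultraFilterLemma eventually_filter.
  apply: (ultrapower_bounded_roots ooU); apply: tf => p _.
  exact: models_ultrapower.
by split=> //; split=> //; rewrite -S12.
Qed.
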